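(* Let $(X,m_s)$ be a complete $M_s$-metric space, let $\phi:[0,\infty)\to[0,\infty)$ be a continuous and non-decreasing function with $\phi^{-1}(0)=\{0\}$ and $\phi(t)>0$ for all $t>0$, and let $T:X\to X$ be a self mapping such that $$m_s(Tx,Ty,Tz)\le m_s(x,y,z)-\phi(m_s(x,y,z))\qquad\text{for all } x,y,z\in X.$$ Then $T$ has a unique fixed point in $X$.
   Context: For a nonempty set $X$ and a function $m_s:X^3\to[0,\infty)$ write $$m_{s_{x,y,z}}:=\min\{m_s(x,x,x),m_s(y,y,y),m_s(z,z,z)\},\qquad M_{s_{x,y,z}}:=\max\{m_s(x,x,x),m_s(y,y,y),m_s(z,z,z)\}.$$ The function $m_s$ is an $M_s$-metric on $X$, and $(X,m_s)$ is an $M_s$-metric space, if for all $x,y,z,t\in X$: (1) $m_s(x,x,x)=m_s(y,y,y)=m_s(x,x,y)$ if and only if $x=y$; (2) $m_{s_{x,y,z}}\le m_s(x,y,z)$; (3) $m_s(x,x,y)=m_s(y,y,x)$; (4) $m_s(x,y,z)-m_{s_{x,y,z}}\le (m_s(x,x,t)-m_{s_{x,x,t}})+(m_s(y,y,t)-m_{s_{y,y,t}})+(m_s(z,z,t)-m_{s_{z,z,t}})$. A sequence $\{x_n\}$ in $X$ converges to $x\in X$ if $\lim_{n\to\infty}(m_s(x_n,x_n,x)-m_{s_{x_n,x_n,x}})=0$. A sequence $\{x_n\}$ is $M_s$-Cauchy if the limits $\lim_{n,m\to\infty}(m_s(x_n,x_n,x_m)-m_{s_{x_n,x_n,x_m}})$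 and $\lim_{n,m\to\infty}(M_{s_{x_n,x_n,x_m}}-m_{s_{x_n,x_n,x_m}})$ exist and are finite. The space $(X,m_s)$ is complete if every $M_s$-Cauchy sequence $\{x_n\}$ converges to a point $x\in X$ such that $\lim_{n\to\infty}(m_s(x_n,x_n,x)-m_{s_{x_n,x_n,x}})=0$ and $\lim_{n\to\infty}(M_{s_{x_n,x_n,x}}-m_{s_{x_n,x_n,x}})=0$. *)

(* Defs.v *)
From HB Require Import structures.
From mathcomp Require Import all_boot all_order all_algebra.
From mathcomp Require Import all_classical all_reals all_analysis.

Set Implicit Arguments.
Unset Strict Implicit.
Unset Printing Implicit Defensive.

Import Order.TTheory GRing.Theory Num.Theory.
Import numFieldNormedType.Exports.

Local Open Scope classical_set_scope.
Local Open Scope ring_scope.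

Definition min_self (R : realType) (X : Type) (ms : X -> X -> X -> R)
    (x y z : X) : R :=
  Num.min (ms x x x) (Num.min (ms y y y) (ms z z z)).

Definition max_self (R : realType) (X : Type) (ms : X -> X -> X -> R)
    (x y z : X) : R :=
  Num.max (ms x x x) (Num.max (ms y y y) (ms z z z)).

Record is_Ms_metric (R : realType) (X : Type) (ms : X -> X -> X -> R) : Prop := {
  Ms_ge0 : forall x y z, 0 <= ms x y z ;
  Ms_eq : forall x y,
    (ms x x x = ms y y y /\ ms y y y = ms x x y) <-> x = y ;
  Ms_min_le : forall x y z, min_self ms x y z <= ms x y z ;
  Ms_sym : forall x y, ms x x y = ms y y x ;
  Ms_triangle : forall x y z t,
    ms x y z - min_self ms x y z <=
      (ms x x t - min_self ms x x t) + (ms y y t - min_self ms y y t)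
      + (ms z z t - min_self ms z z t)
}.

Definition Ms_converges (R : realType) (X : Type) (ms : X -> X -> X -> R)
    (u : nat -> X) (x : X) : Prop :=
  (ms (u n) (u n) x - min_self ms (u n) (u n) x) @[n --> \oo] --> (0 : R).

(* [filter_prod \oo \oo] makes these genuine double limits: both indices tend
   to infinity independently. Limits in [R] are finite. *)
Definition Ms_cauchy (R : realType) (X : Type) (ms : X -> X -> X -> R)
    (u : nat -> X) : Prop :=
  (exists l : R,
     (ms (u p.1) (u p.1) (u p.2) - min_self ms (u p.1) (u p.1) (u p.2))
       @[p --> filter_prod \oo \oo] --> l) /\
  (exists l : R,
     (max_self ms (u p.1) (u p.1) (u p.2) - min_self ms (u p.1) (u p.1) (u p.2))
       @[p --> filter_prod \oo \oo] --> l).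

Definition Ms_complete (R : realType) (X : Type) (ms : X -> X -> X -> R) : Prop :=
  forall u : nat -> X, Ms_cauchy ms u ->
    exists x : X,
      Ms_converges ms u x /\
      (max_self ms (u n) (u n) x - min_self ms (u n) (u n) x)
        @[n --> \oo] --> (0 : R).

(* Main.v *)
Require Import Defs.
From HB Require Import structures.
From mathcomp Require Import all_boot all_order all_algebra.
From mathcomp Require Import all_classical all_reals all_analysis.
From mathcomp Require Import lra.

Set Implicit Arguments.
Unset Strict Implicit.
Unset Printing Implicit Defensive.

Import Order.TTheory GRing.Theory Num.Theory.
Import numFieldNormedType.Exports.

Local Open Scope classical_set_scope.
Local Open Scope ring_scope.

(** Why [T] has exactly one fixed point.

    Only the two-point values [ms x x y] matter.  Subtracting the smaller of
    the two self-distances gives [excess ms x y], which is nonnegative and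
    symmetric, and the triangle axiom becomes
    [excess x y <= excess x t *+ 2 + excess y t]: going from [x] to [y] through
    [t], one of the two legs, freely chosen, is counted only once.

    Along a Picard orbit [u n = T^n x0] both the self-distances
    [ms (u n) (u n) (u n)] and the steps [ms (u n) (u n) (u n.+1)] tend to [0],
    because each loses at least [phi] of itself at every iteration
    ([phi_decrease_cvg0]).  For arbitrary [x] and [y], the triangle
    inequality through [T x] and then [T y] compares [ms x x y] with
    [ms (T x) (T x) (T y)], with coefficient one thanks to the remark above;
    the contraction lowers the latter by [phi (ms x x y)], so the two copies of
    [ms x x y] cancel and
    [phi (ms x x y) <= min_self x x y + 2 (ms x x (T x) + ms y y (T y))]
    ([phi_le_steps]).  Two almost fixed points with small self-distances are
    therefore close to each other.  On the orbit this makes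
    [ms (u n) (u n) (u m)] tend to [0] as a double limit, so the orbit is
    Cauchy.

    Let [x] be the limit provided by completeness.  The second half of the
    completeness condition forces [ms x x x = 0], and then [T x] has
    self-distance [0] as well.  As [u n.+1] approaches both [x] and [T x],
    the triangle inequality gives [ms x x (T x) = 0], and the separation axiom
    gives [T x = x].  Uniqueness is immediate: for fixed points [x] and [y] the
    contraction reads [ms x x y <= ms x x y - phi (ms x x y)], so [ms x x y] and
    the two self-distances vanish. *)

(** * The two-point excess *)

Definition excess (R : realType) (X : Type) (ms : X -> X -> X -> R) (x y : X) :=
  ms x x y - min_self ms x x y.

Lemma min_self2 (R : realType) (X : Type) (ms : X -> X -> X -> R) (x y : X) :
  min_self ms x x y = Num.min (ms x x x) (ms y y y).
Proof. by rewrite /min_self minA minxx. Qed.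

Lemma max_self2 (R : realType) (X : Type) (ms : X -> X -> X -> R) (x y : X) :
  max_self ms x x y = Num.max (ms x x x) (ms y y y).
Proof. by rewrite /max_self maxA maxxx. Qed.

Lemma max_self_sub_min_self (R : realType) (X : Type) (ms : X -> X -> X -> R)
    (x y : X) :
  max_self ms x x y - min_self ms x x y = `|ms x x x - ms y y y|.
Proof.
rewrite max_self2 min_self2; have [xy|yx] := leP (ms x x x) (ms y y y).
- by rewrite distrC ger0_norm ?subr_ge0.
- by rewrite ger0_norm ?subr_ge0 ?ltW.
Qed.

Lemma min_self_ge0 (R : realType) (X : Type) (ms : X -> X -> X -> R)
    (hms : is_Ms_metric ms) (x y : X) : 0 <= min_self ms x x y.
Proof. by rewrite min_self2 le_min !(Ms_ge0 hms). Qed.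

Lemma excess_ge0 (R : realType) (X : Type) (ms : X -> X -> X -> R)
    (hms : is_Ms_metric ms) (x y : X) : 0 <= excess ms x y.
Proof. by rewrite subr_ge0 Ms_min_le. Qed.

Lemma excess_le (R : realType) (X : Type) (ms : X -> X -> X -> R)
    (hms : is_Ms_metric ms) (x y : X) : excess ms x y <= ms x x y.
Proof. by rewrite gerBl min_self_ge0. Qed.

Lemma excess_self0 (R : realType) (X : Type) (ms : X -> X -> X -> R)
    (hms : is_Ms_metric ms) (x y : X) :
  ms y y y = 0 -> excess ms x y = ms x x y.
Proof.
by move=> y0; rewrite /excess min_self2 y0 min_r ?subr0 ?(Ms_ge0 hms).
Qed.

Lemma excess_sym (R : realType) (X : Type) (ms : X -> X -> X -> R)
    (hms : is_Ms_metric ms) (x y : X) : excess ms x y = excess ms y x.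
Proof. by rewrite /excess (Ms_sym hms) !min_self2 minC. Qed.

Lemma excess_triangle (R : realType) (X : Type) (ms : X -> X -> X -> R)
    (hms : is_Ms_metric ms) (x y t : X) :
  excess ms x y <= excess ms x t *+ 2 + excess ms y t.
Proof. by rewrite mulr2n; exact: Ms_triangle. Qed.

Lemma Ms_eq0 (R : realType) (X : Type) (ms : X -> X -> X -> R)
    (hms : is_Ms_metric ms) (x y : X) :
  ms x x x = 0 -> ms y y y = 0 -> ms x x y <= 0 -> x = y.
Proof.
move=> x0 y0 xy; apply/(Ms_eq hms); rewrite x0 y0; split=> //.
by apply/esym/le_anti; rewrite xy (Ms_ge0 hms).
Qed.

(** * Weakly contractive decrease *)

(** While [a] stays above [e], monotonicity of [phi] makes each step cost at
    least the fixed amount [phi e], which a nonnegative sequence cannot pay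
    infinitely often. *)
Lemma phi_decrease_cvg0 (R : realType) (phi : R -> R)
    (phi_ge0 : forall t, 0 <= t -> 0 <= phi t)
    (phi_mono : forall s t, 0 <= s -> s <= t -> phi s <= phi t)
    (phi_pos : forall t, 0 < t -> 0 < phi t)
    (a : nat -> R) (a_ge0 : forall n, 0 <= a n)
    (a_dec : forall n, a n.+1 <= a n - phi (a n)) :
  a n @[n --> \oo] --> (0 : R).
Proof.
have a_noninc n m : (n <= m)%N -> a m <= a n.
  elim: m => [|m IH]; first by rewrite leqn0 => /eqP ->.
  rewrite leq_eqVlt => /predU1P[-> //|/IH]; apply: le_trans.
  by apply: le_trans (a_dec m) _; rewrite gerBl phi_ge0.
apply/cvgr0Pnorm_lt => e e0.
have [N aN] : exists N, a N < e.
  apply: contrapT => /forallNP noN.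
  have e_le n : e <= a n by rewrite leNgt; apply/negP/noN.
  have budget n : a n <= a 0%N - phi e *+ n.
    elim: n => [|n IH]; first by rewrite mulr0n subr0.
    have := phi_mono _ _ (ltW e0) (e_le n); have := a_dec n.
    by rewrite mulrSr; lra.
  have [n] : exists n, a 0%N / phi e < n%:R.
    by exists (Num.truncn (a 0%N / phi e)).+1; exact: truncnS_gt.
  rewrite ltr_pdivrMr ?phi_pos // mulrC mulr_natr.
  by have := budget n; have := a_ge0 n; lra.
exists N => // n /= Nn.
by rewrite ger0_norm //; exact: le_lt_trans (a_noninc _ _ Nn) aN.
Qed.

(** * Almost fixed points are close *)

(** Passing from [x] to [y] through [T x] and [T y] costs twice each step and
    once the distance from [T x] to [T y], which the contraction bounds by
    [ms x x y - phi (ms x x y)]. *)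
Lemma phi_le_steps (R : realType) (X : Type) (ms : X -> X -> X -> R)
    (hms : is_Ms_metric ms) (phi : R -> R) (T : X -> X)
    (T_contr : forall x y z,
      ms (T x) (T y) (T z) <= ms x y z - phi (ms x y z)) (x y : X) :
  phi (ms x x y) <=
    min_self ms x x y + (ms x x (T x) + ms y y (T y)) *+ 2.
Proof.
have xTx := excess_le hms x (T x); have yTy := excess_le hms y (T y).
have via_Tx := excess_triangle hms x y (T x).
have via_Ty := excess_triangle hms y (T x) (T y).
have TxTy := le_trans (excess_le hms (T x) (T y)) (T_contr x x y).
move: via_Tx; rewrite {1}/excess => via_Tx.
by lra.
Qed.

Lemma fixpoint_self0 (R : realType) (X : Type) (ms : X -> X -> X -> R)
    (hms : is_Ms_metric ms) (phi : R -> R)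
    (phi_pos : forall t, 0 < t -> 0 < phi t) (T : X -> X)
    (T_contr : forall x y z,
      ms (T x) (T y) (T z) <= ms x y z - phi (ms x y z)) (x y : X) :
  T x = x -> T y = y -> ms x x y = 0.
Proof.
move=> Tx Ty; have := T_contr x x y; rewrite Tx Ty => le_phi.
apply/le_anti; rewrite (Ms_ge0 hms) andbT leNgt; apply/negP => /phi_pos.
by lra.
Qed.

Lemma fixpoint_unique (R : realType) (X : Type) (ms : X -> X -> X -> R)
    (hms : is_Ms_metric ms) (phi : R -> R)
    (phi_pos : forall t, 0 < t -> 0 < phi t) (T : X -> X)
    (T_contr : forall x y z,
      ms (T x) (T y) (T z) <= ms x y z - phi (ms x y z)) (x y : X) :
  T x = x -> T y = y -> x = y.
Proof.
move=> Tx Ty; have ms0 := fixpoint_self0 hms phi_pos T_contr.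
by apply: (Ms_eq0 hms); rewrite ms0.
Qed.

(** * Picard orbits *)

Lemma orbit_cvg0 (R : realType) (X : Type) (ms : X -> X -> X -> R)
    (hms : is_Ms_metric ms) (phi : R -> R)
    (phi_ge0 : forall t, 0 <= t -> 0 <= phi t)
    (phi_mono : forall s t, 0 <= s -> s <= t -> phi s <= phi t)
    (phi_pos : forall t, 0 < t -> 0 < phi t) (T : X -> X)
    (T_contr : forall x y z,
      ms (T x) (T y) (T z) <= ms x y z - phi (ms x y z)) (x y z : X) :
  ms (iter n T x) (iter n T y) (iter n T z) @[n --> \oo] --> (0 : R).
Proof.
by apply: (phi_decrease_cvg0 phi_ge0 phi_mono phi_pos) => n;
  [exact: Ms_ge0 | exact: T_contr].
Qed.

Lemma orbit_cauchy (R : realType) (X : Type) (ms : X -> X -> X -> R)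
    (hms : is_Ms_metric ms) (phi : R -> R)
    (phi_ge0 : forall t, 0 <= t -> 0 <= phi t)
    (phi_mono : forall s t, 0 <= s -> s <= t -> phi s <= phi t)
    (phi_pos : forall t, 0 < t -> 0 < phi t) (T : X -> X)
    (T_contr : forall x y z,
      ms (T x) (T y) (T z) <= ms x y z - phi (ms x y z)) (x0 : X) :
  Ms_cauchy ms (fun n => iter n T x0).
Proof.
set u := fun n => iter n T x0.
have cvg0 := orbit_cvg0 hms phi_ge0 phi_mono phi_pos T_contr.
have self0 : ms (u n) (u n) (u n) @[n --> \oo] --> (0 : R) by exact: cvg0.
have step0 : ms (u n) (u n) (u n.+1) @[n --> \oo] --> (0 : R).
  under eq_fun do rewrite /u iterSr.
  exact: cvg0.
split; exists 0; apply/cvgr0Pnorm_lt => e e0.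
- (* [phi_le_steps] bounds [phi (ms (u n) (u n) (u m))] by one self-distance
     and four steps: five terms, each to be smaller than [phi e / 5]. *)
  have d0 : 0 < phi e / 5 by rewrite divr_gt0 ?phi_pos.
  have /cvgr0Pnorm_lt /(_ _ d0) [N1 _ self_lt] := self0.
  have /cvgr0Pnorm_lt /(_ _ d0) [N2 _ step_lt] := step0.
  exists ([set n | (maxn N1 N2 <= n)%N], [set n | (maxn N1 N2 <= n)%N]).
    by split; exists (maxn N1 N2).
  move=> [n m] /= [].
  rewrite !geq_max => /andP[N1n N2n] /andP[_ N2m].
  rewrite ger0_norm; last exact: excess_ge0.
  apply: le_lt_trans (excess_le hms _ _) _; rewrite ltNge; apply/negP => e_le.
  have phi_e := phi_mono _ _ (ltW e0) e_le.
  have steps := phi_le_steps hms T_contr (u n) (u m).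
  have min_le : min_self ms (u n) (u n) (u m) <= ms (u n) (u n) (u n).
    by rewrite min_self2 ge_min lexx.
  have := le_lt_trans (ler_norm _) (self_lt n N1n).
  have := le_lt_trans (ler_norm _) (step_lt n N2n).
  have := le_lt_trans (ler_norm _) (step_lt m N2m).
  by rewrite /= in steps *; lra.
- have e20 : 0 < e / 2 by rewrite divr_gt0.
  have /cvgr0Pnorm_lt /(_ _ e20) [N _ self_lt] := self0.
  exists ([set n | (N <= n)%N], [set n | (N <= n)%N]); first by split; exists N.
  move=> [n m] /= [Nn Nm].
  rewrite max_self_sub_min_self normr_id.
  apply: le_lt_trans (ler_normB _ _) _.
  by have := self_lt n Nn; have := self_lt m Nm; lra.
Qed.

(** A limit of an orbit, in the strong sense that the self-distances converge
    too, is fixed: its self-distance is the limit [0] of those of the orbit, so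
    [excess] and [ms] agree at [x] and at [T x], and the orbit tends to both. *)
Lemma orbit_limit_fixed (R : realType) (X : Type) (ms : X -> X -> X -> R)
    (hms : is_Ms_metric ms) (phi : R -> R)
    (phi_ge0 : forall t, 0 <= t -> 0 <= phi t)
    (T : X -> X)
    (T_contr : forall x y z,
      ms (T x) (T y) (T z) <= ms x y z - phi (ms x y z)) (x0 x : X) :
  ms (iter n T x0) (iter n T x0) (iter n T x0) @[n --> \oo] --> (0 : R) ->
  Ms_converges ms (fun n => iter n T x0) x ->
  (max_self ms (iter n T x0) (iter n T x0) x
     - min_self ms (iter n T x0) (iter n T x0) x) @[n --> \oo] --> (0 : R) ->
  T x = x.
Proof.
set u := fun n => iter n T x0 => self0 ux gap0.
have T_le a b c : ms (T a) (T b) (T c) <= ms a b c.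
  by apply: le_trans (T_contr a b c) _; rewrite gerBl phi_ge0 // (Ms_ge0 hms).
have x_self0 : ms x x x = 0.
  have to_x : ms (u n) (u n) (u n) @[n --> \oo] --> ms x x x.
    apply/subr_cvg0/norm_cvg0P.
    by under eq_fun do rewrite -max_self_sub_min_self.
  exact: cvg_unique to_x self0.
have Tx0 : ms (T x) (T x) (T x) = 0.
  by apply/le_anti; rewrite (Ms_ge0 hms) andbT -x_self0 T_le.
have ms_ux : ms (u n) (u n) x @[n --> \oo] --> (0 : R).
  by under eq_fun do rewrite -(excess_self0 hms _ x_self0).
have bound n : ms (T x) (T x) x <= ms (u n) (u n) x *+ 2 + ms (u n.+1) (u n.+1) x.
  rewrite -(excess_self0 hms _ x_self0).
  apply: le_trans (excess_triangle hms _ _ (u n.+1)) _.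
  rewrite !(excess_sym hms _ (u n.+1)) !(excess_self0 hms) //.
  by rewrite lerD2r lerMn2r T_le.
apply: (Ms_eq0 hms) => //.
have lim0 : (ms (u n) (u n) x *+ 2 + ms (u n.+1) (u n.+1) x)
    @[n --> \oo] --> (0 : R).
  rewrite -[0]addr0 -[X in _ --> X + _](mul0rn R 2); apply: cvgD.
    exact: cvgMn.
  by rewrite (cvg_shiftS (fun n => ms (u n) (u n) x)).
by apply: (cvgr_to_ge lim0); apply: nearW.
Qed.

(** * The fixed point theorem *)

Theorem theorem3 (R : realType) (X : Type) (X_nonempty : inhabited X)
    (ms : X -> X -> X -> R) (ms_metric : is_Ms_metric ms)
    (ms_complete : Ms_complete ms)
    (phi : R -> R) (phi_ge0 : forall t : R, 0 <= t -> 0 <= phi t)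
    (phi_cont : {within [set t : R | 0 <= t], continuous phi})
    (phi_mono : forall s t : R, 0 <= s -> s <= t -> phi s <= phi t)
    (phi_preim0 : [set t : R | 0 <= t /\ phi t = 0] = [set 0])
    (phi_pos : forall t : R, 0 < t -> 0 < phi t)
    (T : X -> X)
    (T_contr : forall x y z : X,
      ms (T x) (T y) (T z) <= ms x y z - phi (ms x y z)) :
  exists! u : X, T u = u.
Proof.
case: X_nonempty => x0.
have [x [ux gap0]] := ms_complete _
  (orbit_cauchy ms_metric phi_ge0 phi_mono phi_pos T_contr x0).
have self0 := orbit_cvg0 ms_metric phi_ge0 phi_mono phi_pos T_contr x0 x0 x0.
have Tx := orbit_limit_fixed ms_metric phi_ge0 T_contr self0 ux gap0.
by exists x; split=> // y; exact: (fixpoint_unique ms_metric phi_pos T_contr).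
Qed.
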